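(* $\mathcal{L}_{*}$ is a dense $G_\delta$-subset of $\mathbb{R}$.
   Context: $\mathcal{L}_{*}$ is the set of $\alpha\in\mathbb{R}$ such that for every $k\in\mathbb{N}$ there is $(p,q)\in\mathbb{Z}\times\mathbb{N}$ with $p,q$ relatively prime satisfying $$\left|\alpha-\frac{p}{q}\right|<\frac{1}{e^{e^{k^q}}}.$$ *)

(* Defs.v *)
From mathcomp Require Import all_boot all_order all_algebra.
From mathcomp Require Import all_classical all_reals all_analysis.
From mathcomp Require Import borel_hierarchy.
Set Implicit Arguments.
Unset Strict Implicit.
Unset Printing Implicit Defensive.

Import Order.TTheory GRing.Theory Num.Theory.
Import numFieldNormedType.Exports.

Local Open Scope classical_set_scope.
Local Open Scope ring_scope.

(* The natural numbers k and q range over the positive integers. *)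
Definition Lstar (R : realType) : set R :=
  [set alpha : R | forall k : nat, (0 < k)%N ->
     exists (p : int) (q : nat),
       [/\ (0 < q)%N, coprimez p q%:Z &
           `|alpha - p%:~R / q%:R| < 1 / expR (expR (k%:R ^+ q))]].
Arguments Lstar R : clear implicits.

(* Main.v *)
(* Every rational belongs to [Lstar], its own reduced fraction p/q having error
   0 whatever k is; density follows without the Baire category theorem. *)
Require Import Defs.
From mathcomp Require Import all_boot all_order all_algebra.
From mathcomp Require Import all_classical all_reals all_analysis.
From mathcomp Require Import borel_hierarchy.
Import numFieldNormedType.Exports.
Import Order.TTheory GRing.Theory Num.Theory.

Local Open Scope classical_set_scope.
Local Open Scope ring_scope.

(** For fixed [k] the defining condition cuts out a union of open balls centred at the reduced
    fractions, an open set containing every rational. [Lstar] is the countable intersection of these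
    sets, hence a G-delta, and it is dense because the rationals are. *)

Lemma ratr_Lstar (R : realType) (x : rat) : Lstar R (ratr x).
Proof.
move=> k _; exists (numq x), `|denq x|%N; split.
- by rewrite absz_gt0 denq_neq0.
- by rewrite /coprimez /gcdz absz_nat; exact: coprime_num_den.
(* With the denominator cast through [int], [absz_denq] turns the fraction into the unfolding of
   [ratr x]. *)
- rewrite -[_%:R]/((Posz `|denq x|)%:~R) absz_denq subrr normr0.
  by rewrite divr_gt0 ?expR_gt0.
Qed.

Lemma dense_Lstar (R : realType) : dense (Lstar R).
Proof.
move=> O O0 /(@dense_rat R O O0); apply/subset_nonempty; apply: setIS.
by move=> _ [x _ <-]; exact: ratr_Lstar.
Qed.

Lemma Gdelta_Lstar (R : realType) : Gdelta (Lstar R).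
Proof.
(* The shift to [k.+1] lets the index run over all of [nat] while the exponent's base stays
   positive. *)
pose F (k : nat) : set R :=
  \bigcup_(pq in [set pq : int * nat | (0 < pq.2)%N /\ coprimez pq.1 pq.2%:Z])
    ball (pq.1%:~R / pq.2%:R : R) (1 / expR (expR (k.+1%:R ^+ pq.2))).
exists F; first by move=> k; apply: bigcup_open => pq _; exact: ball_open.
apply/seteqP; split => [a La k _ | a Fa [//|k] _].
- have [p [q [q0 pq apq]]] := La k.+1 isT.
  by exists (p, q) => //; rewrite -ball_normE /= distrC.
- have [[p q] /= [q0 pq]] := Fa k I.
  by rewrite -ball_normE /= distrC => apq; exists p, q.
Qed.

Theorem lemma3p24 (R : realType) : dense (Lstar R) /\ Gdelta (Lstar R).
Proof. by split; [exact: dense_Lstar | exact: Gdelta_Lstar]. Qed.
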